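(* Let $n$ be a positive integer and let $K$ be a field of characteristic $p>0$. Suppose that $n\ge p$. For each $k\in\mathbb N$ let $$h_k = x_{11}x_{12}\dots x_{1k} + x_{21}x_{22}\dots x_{2k} + \dots + x_{n1}x_{n2}\dots x_{nk} \in \overline{R}_n,$$ and let $U$ be the $Sym(\mathbb N)$-invariant ideal of $\overline{R}_n$ generated by the set $\{h_k \mid k=1,2,\dots\}$. Then $U$ is not finitely generated as a $Sym(\mathbb N)$-invariant ideal in $\overline{R}_n$.
   Context: Let $\mathbb N = \{1,2,\dots\}$ and let $R_n = K[x_{ij} \mid 1\le i\le n,\ j\in\mathbb N]$ be the polynomial ring over $K$ in the variables $x_{ij}$. Let $S_n = Sym(\{1,2,\dots,n\})$ and $Sym(\mathbb N)$ be the groups of all permutations of $\{1,\dots,n\}$ and of $\mathbb N$, respectively. These groups act on $R_n$ by $K$-algebra automorphisms determined by $\tau(x_{ij}) = x_{\tau(i)j}$ for $\tau\in S_n$ and $\sigma(x_{ij}) = x_{i\sigma(j)}$ for $\sigma\in Sym(\mathbb N)$. Let $\overline{R}_n = \{ f\in R_n \mid \tau(f)=f \text{ for each } \tau\in S_n\}$ be the $K$-subalgebra of symmetric polynomials; it is stable under the action of $Sym(\mathbb N)$. An ideal $I$ of $\overline{R}_n$ is called $Sym(\mathbb N)$-invariant if $\sigma(I)=I$ for all $\sigma\in Sym(\mathbb N)$. The $Sym(\mathbb N)$-invariant ideal of $\overline{R}_n$ generated by a subset $A\subseteq\overline{R}_n$ is the smallest $Sym(\mathbb N)$-invariant ideal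 of $\overline{R}_n$ containing $A$, that is, the ideal of $\overline{R}_n$ generated by $\{\sigma(a)\mid a\in A,\ \sigma\in Sym(\mathbb N)\}$. A $Sym(\mathbb N)$-invariant ideal is finitely generated as a $Sym(\mathbb N)$-invariant ideal if it is generated in this sense by some finite set. *)

(* Defs.v *)
From HB Require Import structures.
From mathcomp Require Import all_boot all_order all_fingroup all_algebra finmap.
From mathcomp Require Import monalg.
From mathcomp Require Import boolp classical_sets cardinality.

Set Implicit Arguments.
Unset Strict Implicit.
Unset Printing Implicit Defensive.

Import GRing.Theory.

Local Open Scope ring_scope.
Local Open Scope classical_set_scope.

(* [N = {1, 2, ...}] is encoded by [nat], and [{1, ..., n}] by ['I_n]: the pair
   [(i, j)] stands for the index of the variable $x_{i+1,j+1}$. *)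
Notation polyR K n := {malg K[{cmonom ('I_n * nat)%type}]}.

Definition polyX (K : fieldType) (n : nat) (i : 'I_n) (j : nat) : polyR K n :=
  << ucm (i, j) >>.

Section Relabel.
Variables (K : fieldType) (I J : choiceType) (phi : I -> J).

Definition relabel_monom (m : {cmonom I}) : {malg K[{cmonom J}]} :=
  \prod_(v <- finsupp m) << ucm (phi v) >> ^+ m v.

Lemma relabel_monomEw (m : {cmonom I}) (d : {fset I}) :
  (finsupp m `<=` d)%fset ->
  relabel_monom m = \prod_(v <- d) << ucm (phi v) >> ^+ m v.
Proof.
move=> le; rewrite /relabel_monom; apply: (big_fset_incl _ le) => v _.
by rewrite -cmE_eq0 => /eqP ->; rewrite expr0.
Qed.

Lemma relabel_monom_mmorphism : mmorphism relabel_monom.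
Proof.
split=> [m1 m2|]; last by rewrite /relabel_monom mdom1 big_seq_fset0.
have le1 : (finsupp m1 `<=` finsupp m1 `|` finsupp m2)%fset by apply: fsubsetUl.
have le2 : (finsupp m2 `<=` finsupp m1 `|` finsupp m2)%fset by apply: fsubsetUr.
rewrite {1}/relabel_monom mdomD (relabel_monomEw le1) (relabel_monomEw le2).
by rewrite -big_split /=; apply: eq_bigr => v _; rewrite cmM exprD.
Qed.

HB.instance Definition _ :=
  isMultiplicative.Build {cmonom I} {malg K[{cmonom J}]} relabel_monom
    relabel_monom_mmorphism.

(* The K-algebra morphism sending the variable of index [v] to that of index
   [phi v]. *)
Definition relabel : {malg K[{cmonom I}]} -> {malg K[{cmonom J}]} :=
  mmap (@malgC {cmonom J} K) relabel_monom.

HB.instance Definition _ := GRing.RMorphism.on relabel.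

Lemma relabelZ : scalable relabel.
Proof. by move=> c f; rewrite /relabel mmapZ /= mul_malgC. Qed.

HB.instance Definition _ :=
  GRing.isScalable.Build K {malg K[{cmonom I}]} {malg K[{cmonom J}]} *:%R
    relabel relabelZ.

Lemma relabelX (v : I) : relabel << ucm v >> = << ucm (phi v) >>.
Proof.
by rewrite /relabel mmapU /= mpolyC1E mul1r /relabel_monom mdomU
  big_seq_fset1 cmUU expr1.
Qed.

End Relabel.

Lemma relabel_comp (K : fieldType) (I J L : choiceType)
    (phi : I -> J) (psi : J -> L) (f : {malg K[{cmonom I}]}) :
  relabel psi (relabel phi f) = relabel (psi \o phi) f.
Proof.
rewrite [relabel phi f]mmapE [RHS]mmapE raddf_sum; apply: eq_bigr => m _.
rewrite [LHS](rmorphM (relabel psi)); congr (_ * _); first exact: mmapC.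
rewrite /relabel_monom [LHS](rmorph_prod (relabel psi)); apply: eq_bigr => v _.
rewrite [LHS](rmorphXn (relabel psi)).
exact: (congr1 (fun g => g ^+ m v) (relabelX K psi (phi v))).
Qed.

Lemma relabel_monomU (K : fieldType) (I J : choiceType) (phi : I -> J)
    (m : {cmonom I}) :
  relabel_monom K phi m =
    << \big[mmul/mone]_(v <- finsupp m) iter (m v) (mmul (ucm (phi v))) mone >>.
Proof.
rewrite /relabel_monom.
elim/big_rec2: _ => [|v m' g _ ->]; first by rewrite -mpolyC1E.
have -> : (<< ucm (phi v) >> : {malg K[{cmonom J}]}) ^+ m v =
    << iter (m v) (mmul (ucm (phi v))) mone >>.
  elim: (m v) => [|k IHk]; first by rewrite expr0 -mpolyC1E.
  rewrite exprS IHk malgM_def fgmulUU mulr1; reflexivity.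
by rewrite malgM_def fgmulUU mulr1.
Qed.

Lemma relabel_id (K : fieldType) (I : choiceType) (phi : I -> I)
    (f : {malg K[{cmonom I}]}) :
  phi =1 id -> relabel phi f = f.
Proof.
move=> phiE; rewrite /relabel mmapE [RHS]monalgE; apply: eq_bigr => m _.
rewrite relabel_monomU [LHS]malgM_def [LHS]fgmulUU mulr1 mul1m.
apply: (congr1 (fun k => << f@_m *g k >>)).
apply/eqP/cmP => i.
have cm_prod (r : seq I) (F : I -> {cmonom I}) :
    (\big[mmul/mone]_(v <- r) F v) i = (\sum_(v <- r) F v i)%N.
  by elim: r => [|v r IHr]; rewrite ?big_nil ?cm1 // !big_cons cmM IHr.
have cm_iter v k : (iter k (mmul (ucm v)) mone) i = (k * (v == i))%N.
  by elim: k => [|k IHk]; rewrite ?cm1 //= cmM IHk cmU mulSn.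
rewrite cm_prod; under eq_bigr do rewrite phiE cm_iter.
case: (boolP (i \in finsupp m)) => [mi|].
  rewrite (big_fsetD1 i) //= eqxx muln1 big1_seq ?addn0 // => v /=.
  by rewrite !inE => /andP[/negbTE -> _]; rewrite muln0.
rewrite -cmE_eq0 => /eqP mi0; rewrite mi0 big1_seq // => v _.
by case: eqP => [->|_]; rewrite ?muln0 // mi0.
Qed.

Section Actions.
Variables (K : fieldType) (n : nat).
Implicit Type f : polyR K n.

Definition row_act (t : 'S_n) : polyR K n -> polyR K n :=
  relabel (fun v => (t v.1, v.2)).
Definition col_act (s : nat -> nat) : polyR K n -> polyR K n :=
  relabel (fun v => (v.1, s v.2)).

HB.instance Definition _ t := GRing.RMorphism.on (row_act t).
HB.instance Definition _ t := GRing.Linear.on (row_act t).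
HB.instance Definition _ s := GRing.RMorphism.on (col_act s).
HB.instance Definition _ s := GRing.Linear.on (col_act s).

Lemma row_actX t i j : row_act t (polyX K i j) = polyX K (t i) j.
Proof. exact: relabelX. Qed.

Lemma col_actX s (i : 'I_n) j : col_act s (polyX K i j) = polyX K i (s j).
Proof. exact: relabelX. Qed.

Lemma row_col_actC t s f : row_act t (col_act s f) = col_act s (row_act t f).
Proof. by rewrite /row_act /col_act !relabel_comp. Qed.

Definition is_symR : {pred polyR K n} :=
  fun f => [forall t : 'S_n, row_act t f == f].

Lemma is_symRP f : reflect (forall t : 'S_n, row_act t f = f) (f \in is_symR).
Proof. exact: 'forall_eqP. Qed.

Lemma is_symR_subalg_closed : GRing.subalg_closed is_symR.
Proof.
split=> [|c f g /is_symRP fS /is_symRP gS|f g /is_symRP fS /is_symRP gS];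
  apply/is_symRP => t.
- exact: rmorph1.
- by rewrite linearP /= fS gS.
- by rewrite rmorphM /= fS gS.
Qed.

HB.instance Definition _ :=
  GRing.isSubalgClosed.Build K (polyR K n) is_symR is_symR_subalg_closed.

End Actions.

Record symR (K : fieldType) (n : nat) : predArgType := SymR {
  symR_val :> polyR K n;
  symR_valP : symR_val \in @is_symR K n
}.

HB.instance Definition _ K n := [isSub for @symR_val K n].
HB.instance Definition _ K n := [Choice of symR K n by <:].
HB.instance Definition _ K n := [SubChoice_isSubAlgebra of symR K n by <:].
HB.instance Definition _ K n := [SubNzRing_isSubComNzRing of symR K n by <:].

Section InvariantIdeals.
Variables (K : fieldType) (n : nat).
Implicit Types (f g : symR K n) (I A : set (symR K n)).

Fact col_act_is_symR (s : nat -> nat) f : col_act s f \in @is_symR K n.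
Proof.
apply/is_symRP => t; rewrite row_col_actC.
by have /is_symRP -> := symR_valP f.
Qed.

Definition symN_act (s : nat -> nat) f : symR K n :=
  SymR (col_act_is_symR s f).

(* MathComp's [idealr_closed] is about boolean predicates and proper ideals. *)
Definition is_ideal I :=
  [/\ I 0, (forall f g, I f -> I g -> I (f + g)) &
      (forall f g, I g -> I (f * g))].

Definition symN_invariant I :=
  forall s : nat -> nat, bijective s -> symN_act s @` I = I.

Definition is_inv_ideal I := is_ideal I /\ symN_invariant I.

Definition inv_ideal_gen A : set (symR K n) := smallest is_inv_ideal A.

Definition inv_ideal_fingen I :=
  exists A, finite_set A /\ I = inv_ideal_gen A.

Lemma symN_act_comp (s s' : nat -> nat) f :
  symN_act s (symN_act s' f) = symN_act (s \o s') f.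
Proof. by apply: val_inj; rewrite /= /col_act relabel_comp. Qed.

Lemma symN_act_id f : symN_act id f = f.
Proof.
by apply: val_inj; apply: relabel_id => -[].
Qed.

Lemma inv_ideal_genP A : is_inv_ideal (inv_ideal_gen A).
Proof.
split; first split.
- by move=> M [[[M0 _ _] _] _].
- move=> f g If Ig M MA; have [[[_ MD _] _] _] := MA.
  by apply: MD; [apply: If|apply: Ig].
- by move=> f g Ig M MA; have [[[_ _ MM] _] _] := MA; apply: MM; apply: Ig.
move=> s bij_s.
have sMP M f : is_inv_ideal M -> M f ->
    forall s', bijective s' -> M (symN_act s' f).
  by move=> [_ Minv] Mf s' bij_s'; rewrite -(Minv s' bij_s'); exists f.
have [s' ss' s's] := bij_s; have bij_s' : bijective s' by exists s.
apply/seteqP; split=> [_ [f If <-] M MA|f If].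
  by apply: sMP (If M MA) _ _; case: MA.
exists (symN_act s' f).
  by move=> M MA; apply: sMP (If M MA) _ _; case: MA.
have ss'id : s \o s' = id by apply/funext => j; exact: s's.
rewrite symN_act_comp ss'id; exact: symN_act_id.
Qed.

Definition hpoly (k : nat) : polyR K n :=
  \sum_(i < n) \prod_(j < k) polyX K i j.

Fact hpoly_is_symR k : hpoly k \in @is_symR K n.
Proof.
apply/is_symRP => t; rewrite /hpoly raddf_sum [RHS](reindex_inj (@perm_inj _ t)).
apply: eq_bigr => i _; rewrite [LHS](rmorph_prod (row_act t)).
by apply: eq_bigr => j _; exact: row_actX.
Qed.

Definition hsym (k : nat) : symR K n := SymR (hpoly_is_symR k).

End InvariantIdeals.

(* Main.v *)
Require Import Defs.
From mathcomp Require Import all_boot all_algebra.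
From mathcomp Require Import all_fingroup finmap monalg.
From mathcomp Require Import cardinality.
From mathcomp Require Import classical_sets.

(** The ideal [U] escapes every finite set of generators because, in each
    degree [k = m + 1], a linear functional separates [h_k] from everything
    that the polynomials [h_1, ..., h_m] and their images under column
    permutations can produce.

    Fix a set [A] of [p] rows and a row [a0] in [A].  A choice [c] of one row
    for each of the first [k] columns gives a multilinear monomial, the product
    of the variables in positions [(c j, j)].  The functional [coef_sum] adds
    the coefficients of [f] at these monomials, over the choices with values in
    [A] that pick [a0] in the first column.  Only the choice constant equal to
    [a0] meets [h_k], so the value at [h_k] is 1 ([coef_sum_full]).

    Let [g] be symmetric and let [S] be a nonempty proper set of the first [k]
    columns.  The polynomial [g * h_S], where [h_S] sums over the rows the
    products of the variables in the columns of [S], has value 0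
    ([coef_sum_short]).  Indeed, the choices that contribute are those constant
    on [S], and such a choice [c] contributes the coefficient of [g] at the
    monomial of [c] outside [S].  Of [S] and its complement, let [T] be the one
    that does not contain the first column.  Exchanging [a0] with another row
    of [A] on the columns of [T] alone does not affect the contribution: if [T]
    is [S], the part outside [S] is untouched; if [T] is the complement, that
    part is permuted by rows and [g] is symmetric.  Hence the [p] possible
    values of [c] at a column of [T] contribute equally, and the total is a
    multiple of [p], which is 0 in [K] ([sum_twist]).

    The symmetric polynomials whose whole orbit, times any symmetric
    polynomial, is killed by the functional form an invariant ideal
    ([coef_sum_null]).  Those that lie in this ideal for all large [k] form
    another invariant ideal, which contains every [h_j], hence [U].  A finite
    generating set of [U] would therefore lie in the ideal of a single [k], and
    so would [U]; but [h_k] does not. *)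

Local Open Scope ring_scope.

Set Implicit Arguments.
Unset Strict Implicit.
Unset Printing Implicit Defensive.

Import GRing.Theory.

(** * Coefficients and monomials *)

Section Monomials.
Variables (K : fieldType) (I : choiceType).
Implicit Types (m u v w : {cmonom I}) (g : {malg K[{cmonom I}]}).

Lemma cmonom_prodE (T : Type) (r : seq T) (P : pred T) (F : T -> {cmonom I}) i :
  (\big[mmul/mone]_(x <- r | P x) F x) i = (\sum_(x <- r | P x) F x i)%N.
Proof.
elim/big_rec2: _ => [|x y m _ <-]; first by rewrite cm1.
by rewrite cmM.
Qed.

Lemma monomial_prod (T : Type) (r : seq T) (P : pred T) (F : T -> {cmonom I}) :
  \prod_(x <- r | P x) << F x >> =
    << \big[mmul/mone]_(x <- r | P x) F x >> :> {malg K[{cmonom I}]}.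
Proof.
elim/big_rec2: _ => [|x y m _ ->]; first by rewrite -mpolyC1E.
by rewrite malgM_def fgmulUU mulr1.
Qed.

Lemma mcoeff_mul_monomial g u v : (g * << u >>)@_(mmul v u) = g@_v.
Proof.
rewrite mcoeffMr msuppU1 big_seq_fset1 mcoeffUU.
have cancel_u w : (mmul w u == mmul v u) = (w == v).
  apply/eqP/eqP => [eq_wu|-> //]; apply/eqP/cmP => i; apply/eqP.
  by have /eqP := congr1 (fun m : {cmonom I} => m i) eq_wu; rewrite !cmM eqn_add2r.
rewrite [RHS](congr1 (mcoeff v) (monalgE g)) raddf_sum /=; apply: eq_bigr => w _.
by rewrite cancel_u mulr1 mcoeffU.
Qed.

Lemma mcoeff_mul_monomial_eq0 g u w :
  (forall v, mmul v u != w) -> (g * << u >>)@_w = 0.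
Proof.
move=> Hu; rewrite mcoeffMr msuppU1 big_seq_fset1.
by apply: big1 => v _; rewrite (negbTE (Hu v)).
Qed.

End Monomials.

(** * Coefficients under an injective renaming of the variables *)

Section RelabelCoefficients.
Variables (K : fieldType) (I : choiceType) (phi : I -> I).
Hypothesis phi_inj : injective phi.

(** This expression is the one in which [relabel_monomU] presents the image of
    a monomial. *)
Definition cmonom_relabel (m : {cmonom I}) : {cmonom I} :=
  \big[mmul/mone]_(v <- finsupp m) iter (m v) (mmul (ucm (phi v))) mone.

Lemma cmonom_relabelE m i : cmonom_relabel m (phi i) = m i.
Proof.
rewrite cmonom_prodE.
have cm_iter v k : (iter k (mmul (ucm (phi v))) mone) (phi i) = (k * (v == i))%N.
  elim: k => [|k IHk]; rewrite ?cm1 //= cmM IHk cmU mulSn.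
  by rewrite (inj_eq phi_inj).
under eq_bigr do rewrite cm_iter.
case: (boolP (i \in finsupp m)) => [mi|].
  rewrite (big_fsetD1 i) //= eqxx muln1 big1_seq ?addn0 // => v /=.
  by rewrite !inE => /andP[/negbTE -> _]; rewrite muln0.
rewrite -cmE_eq0 => /eqP mi0; rewrite mi0 big1_seq // => v _.
by case: eqP => [->|_]; rewrite ?muln0 // mi0.
Qed.

Lemma cmonom_relabel_inj : injective cmonom_relabel.
Proof.
move=> m1 m2 eq12; apply/eqP/cmP => i.
by rewrite -(cmonom_relabelE m1) eq12 cmonom_relabelE.
Qed.

Lemma mcoeff_relabel (g : {malg K[{cmonom I}]}) m :
  (relabel phi g)@_(cmonom_relabel m) = g@_m.
Proof.
rewrite [relabel phi g]mmapE [RHS](congr1 (mcoeff m) (monalgE g)) !raddf_sum /=.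
apply: eq_bigr => w _.
rewrite mul_malgC mcoeffZ relabel_monomU !mcoeffU (inj_eq cmonom_relabel_inj).
by rewrite mulr_natr.
Qed.

End RelabelCoefficients.

(** * Multilinear monomials and choices of rows *)

Section MultilinearMonomials.
Variables (K : fieldType) (n k : nat).
Implicit Types (T : {set 'I_k}) (c : {ffun 'I_k -> 'I_n}) (i : 'I_n).
Implicit Types (s : seq nat).

Definition choice_monom T c : {cmonom ('I_n * nat)%type} :=
  \big[mmul/mone]_(j in T) ucm (c j, nat_of_ord j).

Definition row_monom i s : {cmonom ('I_n * nat)%type} :=
  \big[mmul/mone]_(j <- s) ucm (i, j).

Lemma choice_monomE T c i (j : 'I_k) :
  choice_monom T c (i, nat_of_ord j) = (j \in T) && (c j == i) :> nat.
Proof.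
rewrite cmonom_prodE; case: (boolP (j \in T)) => jT /=.
  rewrite (bigD1 j) //= ucmE xpair_eqE eqxx andbT big1 ?addn0 // => l /andP[_ lj].
  by rewrite ucmE xpair_eqE -[_ == _ :> nat]/(l == j) (negbTE lj) andbF.
apply: big1 => l lT; rewrite ucmE xpair_eqE -[_ == _ :> nat]/(l == j).
by case: (l =P j) lT jT => [-> ->|]; rewrite ?andbF.
Qed.

Lemma choice_monom_out T c i j : (k <= j)%N -> choice_monom T c (i, j) = 0%N.
Proof.
move=> le_kj; rewrite cmonom_prodE; apply: big1 => l _.
by rewrite ucmE xpair_eqE [X in _ && X]ltn_eqF ?andbF // (leq_trans (ltn_ord l)).
Qed.

Lemma row_monomE i s i' j : row_monom i s (i', j) = ((i == i') * count_mem j s)%N.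
Proof.
rewrite cmonom_prodE; elim: s => [|l s IHs]; rewrite ?big_nil ?muln0 // big_cons.
by rewrite IHs ucmE xpair_eqE /= mulnDr -mulnb.
Qed.

Definition cols s : {set 'I_k} := [set j : 'I_k | nat_of_ord j \in s].

Lemma choice_monom_split c i s :
    uniq s -> all (fun j => (j < k)%N) s -> (forall j, j \in cols s -> c j = i) ->
  choice_monom [set: 'I_k] c = mmul (choice_monom (~: cols s) c) (row_monom i s).
Proof.
move=> s_uniq /allP ltsk c_s; apply/eqP/cmP => -[i' j]; rewrite cmM row_monomE.
have [le_kj|lt_jk] := leqP k j.
  rewrite !choice_monom_out // count_uniq_mem //.
  by case: (boolP (j \in s)) => [/ltsk|]; rewrite ?muln0 // ltnNge le_kj.
rewrite -[j]/(nat_of_ord (Ordinal lt_jk)); set l := Ordinal lt_jk.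
rewrite !choice_monomE count_uniq_mem // !inE /=.
case: (boolP (j \in s)) => [js|_] /=; last by rewrite muln0 addn0.
by rewrite c_s ?inE // muln1.
Qed.

Lemma row_monom_dvd c i s v :
    mmul v (row_monom i s) = choice_monom [set: 'I_k] c ->
  all (fun j => (j < k)%N) s && [forall j in cols s, c j == i].
Proof.
move=> eqv.
have pos j : j \in s -> (0 < choice_monom [set: 'I_k] c (i, j))%N.
  move=> js; rewrite -eqv cmM row_monomE eqxx mul1n addn_gt0.
  by rewrite -has_count has_pred1 js orbT.
apply/andP; split; first apply/allP => j /pos.
  by case: (ltnP j k) => // le_kj; rewrite choice_monom_out.
by apply/forall_inP => j; rewrite inE => /pos; rewrite choice_monomE inE /=; case: eqP.
Qed.

(** A row monomial divides the multilinear monomial of a choice [c] exactly when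
    its columns are in range and [c] is constant, equal to that row, on them;
    the quotient is then the monomial of [c] on the other columns. *)
Lemma mcoeff_mul_row_monom (g : polyR K n) c i s : uniq s ->
  (g * << row_monom i s >>)@_(choice_monom [set: 'I_k] c) =
    if all (fun j => (j < k)%N) s && [forall j in cols s, c j == i]
    then g@_(choice_monom (~: cols s) c) else 0.
Proof.
move=> s_uniq; case: ifP => [/andP[ltsk /forall_inP c_s]|not_dvd].
  rewrite (@choice_monom_split c i s) ?mcoeff_mul_monomial //.
  by move=> j /c_s/eqP.
by apply: mcoeff_mul_monomial_eq0 => v; apply/eqP => /row_monom_dvd; rewrite not_dvd.
Qed.

Definition twist T (t : 'S_n) c : {ffun 'I_k -> 'I_n} :=
  [ffun j => if j \in T then t (c j) else c j].

(** Twisting on the whole support of the monomial is the action of a row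
    permutation, which fixes [g]. *)
Lemma mcoeff_twist (g : polyR K n) T t c : g \in @is_symR K n ->
  g@_(choice_monom T (twist T t c)) = g@_(choice_monom T c).
Proof.
move=> /is_symRP g_sym; pose phi (v : 'I_n * nat) := (t v.1, v.2).
have phi_inj : injective phi.
  by move=> [a b] [a' b'] [] /perm_inj -> ->.
rewrite -[RHS](mcoeff_relabel phi_inj) -[relabel phi g]/(row_act t g) g_sym.
congr (_@_ _); apply/eqP/cmP => -[a j].
have -> : (a, j) = phi ((t^-1)%g a, j) by rewrite /phi /= permKV.
rewrite cmonom_relabelE // /phi /= permKV.
have [le_kj|lt_jk] := leqP k j; first by rewrite !choice_monom_out.
rewrite -[j]/(nat_of_ord (Ordinal lt_jk)) !choice_monomE ffunE.
case: ifP => //= _; congr nat_of_bool.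
by apply/eqP/eqP => [<-|->]; rewrite ?permK ?permKV.
Qed.

(** The choices are sorted by their value at [t0].  The twist that exchanges
    [a0] and [v] is a bijection from the class of [a0] to the class of [v], so
    the classes of all [v] in [A] have the same sum. *)
Lemma sum_twist (F : {ffun 'I_k -> 'I_n} -> K) (A : {set 'I_n}) a0 T t0 :
    t0 \in T ->
    (forall c v, v \in A -> F (twist T (tperm a0 v) c) = F c) ->
    (forall c, c t0 \notin A -> F c = 0) ->
  \sum_c F c = (\sum_(c : {ffun 'I_k -> 'I_n} | c t0 == a0) F c) *+ #|A|.
Proof.
move=> t0T F_twist F_out.
rewrite (partition_big (fun c : {ffun _} => c t0) predT) //= -sumr_const.
rewrite (bigID (mem A)) /= [X in _ + X]big1 ?addr0; last first.
  by move=> v vA; apply: big1 => c /eqP ct0; apply: F_out; rewrite ct0.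
apply: eq_bigr => v vA.
have twistK : involutive (twist T (tperm a0 v)).
  by move=> c; apply/ffunP => j; rewrite !ffunE; case: (j \in T); rewrite ?tpermK.
rewrite (reindex_inj (inv_inj twistK)); apply: eq_big => [c|c _]; last exact: F_twist.
by rewrite ffunE t0T -(inj_eq (@perm_inj _ (tperm a0 v))) tpermK tpermR.
Qed.

End MultilinearMonomials.

(** * The separating functional *)

Section Functional.
Variables (K : fieldType) (n m : nat) (A : {set 'I_n}) (a0 : 'I_n).
Hypotheses (A_a0 : a0 \in A) (cardA : (#|A|%:R : K) = 0).

(** Without the condition on the first column, each of the constant choices
    with value in [A] would meet [h_k], and the functional would take there the
    value [#|A|], which is 0 in [K]. *)
Definition rooted (c : {ffun 'I_m.+1 -> 'I_n}) : bool :=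
  (c ord0 == a0) && [forall j, c j \in A].

Definition coef_sum (f : polyR K n) : K :=
  \sum_(c | rooted c) f@_(choice_monom [set: 'I_m.+1] c).

Lemma coef_sumD f g : coef_sum (f + g) = coef_sum f + coef_sum g.
Proof. by rewrite -big_split; apply: eq_bigr => c _; rewrite mcoeffD. Qed.

Lemma coef_sum0 : coef_sum 0 = 0.
Proof. by apply: big1 => c _; rewrite mcoeff0. Qed.

Lemma coef_sum_mul_rows g s : uniq s ->
  coef_sum (g * \sum_i << row_monom i s >>) =
    if all (fun j => (j < m.+1)%N) s then
      \sum_(c | rooted c) \sum_(i | [forall j in cols m.+1 s, c j == i])
        g@_(choice_monom (~: cols m.+1 s) c)
    else 0.
Proof.
move=> s_uniq; rewrite /coef_sum.
under eq_bigr do rewrite mulr_sumr raddf_sum /=.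
under eq_bigr do under eq_bigr do rewrite mcoeff_mul_row_monom //.
case: ifP => _ /=; first by apply: eq_bigr => c _; rewrite -big_mkcond.
by apply: big1 => c _; apply: big1.
Qed.

(** The size bounds make both the set of columns [S] and its complement
    nonempty, so that one of them avoids the first column and still has an
    element [t0] at which the value of a choice is free to vary over [A]. *)
Lemma coef_sum_short g s : g \in @is_symR K n -> uniq s ->
    (0 < size s <= m)%N ->
  coef_sum (g * \sum_i << row_monom i s >>) = 0.
Proof.
move=> g_sym s_uniq /andP[s_gt0 le_sm]; rewrite coef_sum_mul_rows //.
case: ifP => // /allP lt_s; set S := cols _ s.
have cardS : (#|S| = size s)%N.
  have -> : S = [set j in (pmap insub s : seq 'I_m.+1)].
    by apply/setP => j; rewrite !inE mem_pmap_sub.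
  rewrite cardsE (card_uniqP (pmap_sub_uniq _ s_uniq)) size_pmap_sub.
  by apply/eqP; rewrite -all_count; apply/allP.
pose T := if ord0 \in S then ~: S else S.
have T0 : ord0 \notin T.
  by rewrite /T; case: ifP => [S0|->] //; rewrite inE S0.
have [t0 t0T] : exists t0, t0 \in T.
  apply/set0Pn; rewrite -card_gt0 /T; case: ifP => _; last by rewrite cardS.
  by rewrite cardsCs finset.setCK card_ord cardS subn_gt0.
have [s0 s0S] : exists s0, s0 \in S by apply/set0Pn; rewrite -card_gt0 cardS.
(* A choice that contributes has a single matching row, its value at [s0]. *)
pose F c := if rooted c && [forall j in S, c j == c s0]
            then g@_(choice_monom (~: S) c) else 0.
transitivity (\sum_c F c).
  rewrite big_mkcond; apply: eq_bigr => c _; rewrite /F; case: ifP => //= _.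
  case: ifP => [/forall_inP c_S|/negP not_c_S].
    rewrite (big_pred1 (c s0)) // => i /=.
    apply/forall_inP/eqP => [/(_ _ s0S)/eqP //|-> j jS].
    exact: c_S.
  apply: big_pred0 => i; apply: contra_notF not_c_S => /forall_inP c_S.
  by apply/forall_inP => j jS; rewrite (eqP (c_S j jS)) eq_sym c_S.
rewrite (@sum_twist K n m.+1 F A a0 T t0) //; last 2 first.
- move=> c v vA; rewrite /F.
  have A_tperm a : (tperm a0 v a \in A) = (a \in A).
    by case: tpermP => [->|->|//]; rewrite ?vA A_a0.
  have -> : rooted (twist T (tperm a0 v) c) = rooted c.
    rewrite /rooted ffunE (negbTE T0); congr (_ && _).
    by apply: eq_forallb => j; rewrite ffunE; case: ifP => // _; rewrite A_tperm.
  have -> : [forall j in S, twist T (tperm a0 v) c j == twist T (tperm a0 v) c s0] =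
            [forall j in S, c j == c s0].
    apply: eq_forallb_in => j jS; rewrite !ffunE /T.
    by case: (ord0 \in S); rewrite !(finset.in_setC, jS, s0S) //= (inj_eq perm_inj).
  case: ifP => // _; rewrite /T; case: ifP => _; first exact: mcoeff_twist.
  congr (_@_ _); apply: eq_bigr => j; rewrite inE ffunE => /negbTE -> //.
- move=> c ct0A; rewrite /F /rooted.
  by case: forallP => [/(_ t0)|_]; rewrite ?(negbTE ct0A) ?andbF.
by rewrite -mulr_natr cardA mulr0.
Qed.

Lemma coef_sum_full : coef_sum (\sum_i << row_monom i (iota 0 m.+1) >>) = 1.
Proof.
rewrite -[X in coef_sum X]mul1r coef_sum_mul_rows ?iota_uniq //.
have -> : all (fun j => (j < m.+1)%N) (iota 0 m.+1).
  by apply/allP => j; rewrite mem_iota.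
have -> : cols m.+1 (iota 0 m.+1) = [set: 'I_m.+1].
  by apply/setP => j; rewrite finset.in_set finset.in_setT (mem_iota 0) leq0n ltn_ord.
rewrite (bigD1 ([ffun=> a0] : {ffun 'I_m.+1 -> 'I_n})) //=; last first.
  by rewrite /rooted ffunE eqxx; apply/forallP => j; rewrite ffunE.
rewrite [X in _ + X]big1 ?addr0.
  rewrite (big_pred1 a0) => [|i /=].
    by rewrite finset.setCT /choice_monom big_set0 mcoeff1 eqxx.
  apply/forall_inP/eqP => [/(_ ord0 (finset.in_setT _))|-> j _]; rewrite ffunE //.
  by move/eqP.
move=> c /andP[/andP[/eqP c0 _] cN]; apply: big_pred0 => i.
apply: contraNF cN => /forall_inP c_i; apply/eqP/ffunP => j.
rewrite ffunE -c0 (eqP (c_i j (finset.in_setT _))).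
by rewrite (eqP (c_i ord0 (finset.in_setT _))).
Qed.

End Functional.

Local Open Scope classical_set_scope.

(** * Invariant ideals of symmetric polynomials *)

Section Ideals.
Variables (K : fieldType) (n : nat).
Implicit Types (f g : symR K n) (I : set (symR K n)) (s : nat -> nat).

(** Stability suffices for invariance, since the inverse of a permutation is a
    permutation. *)
Lemma is_inv_ideal_closed I : is_ideal I ->
  (forall s f, bijective s -> I f -> I (symN_act s f)) -> is_inv_ideal I.
Proof.
move=> I_ideal I_act; split=> // s s_bij; apply/seteqP; split=> [_ [f If <-]|f If].
  exact: I_act.
have [s' ss' s's] := s_bij; exists (symN_act s' f).
  by apply: I_act If; exists s.
rewrite symN_act_comp.
have -> : s \o s' = id by apply/boolp.funext => j; exact: s's.
exact: symN_act_id.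
Qed.

Lemma symR_valD f g : symR_val (f + g) = symR_val f + symR_val g.
Proof. reflexivity. Qed.

Lemma symR_valM f g : symR_val (f * g) = symR_val f * symR_val g.
Proof. reflexivity. Qed.

Lemma col_act_hpoly s k : col_act s (hpoly K n k) =
  \sum_i << row_monom i [seq s j | j <- iota 0 k] >>.
Proof.
rewrite /hpoly raddf_sum; apply: eq_bigr => i _ /=.
rewrite rmorph_prod /row_monom -monomial_prod big_map.
have -> : iota 0 k = index_iota 0 k by rewrite /index_iota subn0.
rewrite big_mkord.
by apply: eq_bigr => j _; exact: col_actX.
Qed.

Variables (A : {set 'I_n}) (a0 : 'I_n).

(** The kernel of the functional is not an ideal; quantifying over all symmetric
    multipliers and all permutations of the columns gives the largest invariant
    ideal inside it. *)
Definition coef_sum_null m : set (symR K n) :=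
  [set f | forall (g : polyR K n) s, g \in @is_symR K n -> bijective s ->
    coef_sum m A a0 (g * col_act s (symR_val f)) = 0].

Lemma coef_sum_null_inv_ideal m : is_inv_ideal (coef_sum_null m).
Proof.
apply: is_inv_ideal_closed; first split.
- by move=> g s _ _; rewrite raddf0 mulr0 coef_sum0.
- move=> f f' Nf Nf' g s g_sym s_bij.
  rewrite symR_valD.
  rewrite [col_act _ _](raddfD (col_act s)) /= mulrDr coef_sumD.
  by rewrite -[RHS]addr0; congr (_ + _); [exact: Nf|exact: Nf'].
- move=> f f' Nf' g s g_sym s_bij; rewrite symR_valM rmorphM mulrA.
  by apply: Nf' => //; apply: rpredM => //; exact: col_act_is_symR.
move=> s f s_bij Nf g s' g_sym s'_bij.
rewrite -[col_act s' _]/(symR_val (symN_act s' (symN_act s f))) symN_act_comp.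
by apply: Nf => //; exact: bij_comp.
Qed.

(** Nullity for all large [m], rather than for some [m], makes this set stable
    under addition and gives finitely many elements a common [m]. *)
Definition eventually_null : set (symR K n) :=
  [set f | exists N, forall m, (N <= m)%N -> coef_sum_null m f].

Lemma eventually_null_inv_ideal : is_inv_ideal eventually_null.
Proof.
apply: is_inv_ideal_closed; first split.
- by exists 0%N => m _; have [[]] := coef_sum_null_inv_ideal m.
- move=> f g [M Mf] [N Ng]; exists (maxn M N) => m; rewrite geq_max => /andP[Mm Nm].
  have [[_ nullD _] _] := coef_sum_null_inv_ideal m.
  by apply: nullD; [exact: Mf|exact: Ng].
- move=> f g [N Ng]; exists N => m Nm.
  have [[_ _ nullM] _] := coef_sum_null_inv_ideal m.
  by apply: nullM; exact: Ng.
move=> s f s_bij [N Nf]; exists N => m Nm.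
have [_ null_inv] := coef_sum_null_inv_ideal m; rewrite -(null_inv s s_bij).
by exists f => //; exact: Nf.
Qed.

Hypotheses (A_a0 : a0 \in A) (cardA : (#|A|%:R : K) = 0).

Lemma hsym_null k m : (0 < k <= m)%N -> coef_sum_null m (hsym K n k).
Proof.
move=> k_m g s g_sym s_bij /=; rewrite col_act_hpoly.
apply: coef_sum_short => //.
  by rewrite map_inj_uniq ?iota_uniq //; exact: bij_inj.
by rewrite size_map size_iota.
Qed.

Lemma hsym_not_null m : ~ coef_sum_null m (hsym K n m.+1).
Proof.
have id_bij : bijective (@id nat) by exists id.
move=> /(_ 1 id (rpred1 _) id_bij)/eqP.
by rewrite col_act_hpoly map_id mul1r coef_sum_full // oner_eq0.
Qed.

End Ideals.

Lemma finite_common_bound (T : eqType) (B : set T) (P : nat -> T -> Prop) :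
    finite_set B ->
    (forall x, B x -> exists N, forall m, (N <= m)%N -> P m x) ->
  exists N, forall x, B x -> P N x.
Proof.
move=> /finite_seqP[r ->] P_ev.
suff [N PN] : exists N, forall m, (N <= m)%N -> forall x, x \in r -> P m x.
  by exists N => x; exact: PN.
elim: r P_ev => [|y r IHr] P_ev; first by exists 0%N.
have [M PM] := P_ev y (mem_head y r).
have [x xr|N PN] := IHr; first by apply: P_ev; rewrite /= inE xr orbT.
exists (maxn M N) => m; rewrite geq_max => /andP[Mm Nm] x.
by rewrite inE => /predU1P[-> | xr]; [exact: PM|exact: PN].
Qed.

Theorem theorem6 (n : nat) (n_gt0 : (0 < n)%N) (p : nat) (K : fieldType)
    (charKp : p \in [pchar K]) (le_pn : (p <= n)%N) :
  ~ inv_ideal_fingen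
      (inv_ideal_gen [set hsym K n k | k in [set k : nat | (0 < k)%N]]).
Proof.
case=> B [B_fin UB]; set H := [set hsym K n k | k in _] in UB.
have p_gt0 : (0 < p)%N by apply: prime_gt0; exact: pcharf_prime charKp.
pose A : {set 'I_n} := [set i : 'I_n | (i < p)%N]%SET.
pose a0 : 'I_n := Ordinal n_gt0.
have A_a0 : a0 \in A by rewrite inE.
have cardA : (#|A|%:R : K) = 0.
  have -> : #|A| = p.
    rewrite -sum1_card -[RHS]card_ord -[RHS]sum1_card.
    rewrite (big_ord_widen n (fun=> 1%N) le_pn).
    by apply: eq_bigl => i; rewrite inE.
  exact: pcharf0.
have U_eventually : inv_ideal_gen H `<=` eventually_null A a0.
  apply: smallest_sub; first exact: eventually_null_inv_ideal.
  by move=> _ [k k_gt0 <-]; exists k => m km; apply: hsym_null => //; apply/andP.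
have [|m Bm] := finite_common_bound (P := fun m => coef_sum_null A a0 m) B_fin.
  by move=> f Bf; apply: U_eventually; rewrite UB; exact: sub_gen_smallest.
have U_null : inv_ideal_gen B `<=` coef_sum_null A a0 m.
  by apply: smallest_sub; [exact: coef_sum_null_inv_ideal|exact: Bm].
apply: (@hsym_not_null K n A a0 A_a0 m); apply: U_null; rewrite -UB.
by apply: sub_gen_smallest; exists m.+1.
Qed.
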